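(* The primal-dual algorithm described in the context solves $(P_{=k})$ using at most $k\times|E|$ primal or dual augmentations. Moreover, the entire sequence of optimal solutions $(X_k,Y_k)$ for all problems $(P_{=k})$ with $k=0,1,\dots,K$ can be computed within $|E|^2$ primal or dual augmentations.
   Context: An instance of $(P_{=k})$ consists of two matroids $\mathcal{M}_1=(E,\mathcal{B}_1)$, $\mathcal{M}_2=(E,\mathcal{B}_2)$ on a common finite ground set $E$ with base sets $\mathcal{B}_1,\mathcal{B}_2$, an integer $k$ with $0\le k\le K:=\min\{\operatorname{rk}(\mathcal{M}_1),\operatorname{rk}(\mathcal{M}_2)\}$ (where $\operatorname{rk}$ denotes the rank, i.e. the cardinality of every basis), and cost functions $c_1,c_2\colon E\to\mathbb{R}$. The problem is to minimize $c_1(X)+c_2(Y)$ over $X\in\mathcal{B}_1$, $Y\in\mathcal{B}_2$ with $|X\cap Y|=k$, where $c_i(S)=\sum_{e\in S}c_i(e)$. Auxiliary digraph. For $X\in\mathcal{B}_1$, $Y\in\mathcal{B}_2$ and $\alpha,\beta\in\mathbb{R}^{|E|}_+$, the digraph $D=D(X,Y,\alpha,\beta)$ has vertex set $E$; a red arc $(e,f)$ whenever $e\notin X$, $f\in X$, $X-f+e\in\mathcal{B}_1$ and $c_1(e)-\alpha_e=c_1(f)-\alpha_f$; and a blue arc $(f,g)$ whenever $g\notin Y$, $f\in Y$, $Y-f+g\in\mathcal{B}_2$ and $c_2(g)-\beta_g=c_2(f)-\beta_f$. An augmenting path is a shortest (with respect to the number of arcs) red-blue alternating path from a vertex of $Y\setminus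 X$ to a vertex of $X\setminus Y$. For such a path $P$, $X\oplus P$ is obtained from $X$ by replacing $f$ by $e$ for every red arc $(e,f)$ of $P$, and $Y\oplus P$ is obtained from $Y$ by replacing $f$ by $g$ for every blue arc $(f,g)$ of $P$. Step length. If $D$ has no augmenting path, let $R$ be the set of vertices reachable in $D$ from $Y\setminus X$ on red-blue alternating paths (so $Y\setminus X\subseteq R$). Put $\bar c_1(e)=c_1(e)-\alpha_e$, $\bar c_2(e)=c_2(e)-\beta_e$, and $$\delta_1=\min\{\bar c_1(e)-\bar c_1(f)\mid e\in R\setminus X,\ f\in X\setminus R,\ X-f+e\in\mathcal{B}_1\},$$ $$\delta_2=\min\{\bar c_2(g)-\bar c_2(f)\mid g\notin Y\cup R,\ f\in Y\cap R,\ Y-f+g\in\mathcal{B}_2\},$$ where a minimum over the empty set is $\infty$, and $\delta=\min\{\delta_1,\delta_2\}$. Algorithm (input $\mathcal{M}_1,\mathcal{M}_2,c_1,c_2,k$; output an optimal solution $(X,Y)$ of $(P_{=k})$). 1. Compute an optimal solution $(X,Y)$ of $\min\{c_1(X)+c_2(Y)\mid X\in\mathcal{B}_1,Y\in\mathcal{B}_2\}$. 2. If $|X\cap Y|=k$, return $(X,Y)$ as optimal solution of $(P_{=k})$. 3. Else, if $|X\cap Y|>k$, run the algorithm on $\mathcal{M}_1$, the dual matroid $\mathcal{M}_2^*$ (with bases $E\setminus B$, $B\in\mathcal{B}_2$), costs $c_1$ and $c_2^*:=-c_2$, and parameter $k^*:=\operatorname{rk}(\mathcal{M}_1)-k$,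 starting from the pair $(X,E\setminus Y)$; a solution $(X',Z)$ obtained for this instance corresponds to the solution $(X',E\setminus Z)$ of the original problem. 4. Else, set $\lambda:=0$, $\alpha:=0$, $\beta:=0$. 5. While $|X\cap Y|<k$: construct $D=D(X,Y,\alpha,\beta)$. If there is an augmenting path $P$ in $D$, replace $(X,Y)$ by $(X\oplus P,Y\oplus P)$ (primal augmentation). Else compute the step length $\delta$; if $\delta=\infty$, terminate with the message ''infeasible instance''; else set $\lambda:=\lambda+\delta$, $\alpha_e:=\alpha_e+\delta$ for $e\in R$, and $\beta_e:=\beta_e+\delta$ for $e\notin R$, all other entries unchanged (dual augmentation). 6. Return $(X,Y)$.
   Formalization: When the unconstrained optimum has |X∩Y| > k, the bound k|E| is false (e.g. k = 0), so it is replaced by k*|E| with k* = rk(M1) − k, the parameter of the dual instance on which the loop runs; for |X∩Y| ≤ k the bound is k|E| as stated. *)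

(* Defs.v *)
From HB Require Import structures.
From mathcomp Require Import all_boot all_order all_algebra.
From mathcomp Require Import boolp reals constructive_ereal.

Set Implicit Arguments.
Unset Strict Implicit.
Unset Printing Implicit Defensive.

Import Order.TTheory GRing.Theory Num.Theory.

Local Open Scope ring_scope.

Record matroid (E : finType) := Matroid {
  bases : {set {set E}};
  bases_neq0 : bases != set0;
  basis_exchange : forall A B, A \in bases -> B \in bases ->
    forall x, x \in A :\: B ->
    exists2 y, y \in B :\: A & y |: (A :\ x) \in bases }.

Section MatroidTheory.
Variables (E : finType) (M : matroid E).
Implicit Types A B : {set E}.

(* All bases have the same cardinality (card_basis), so the maximum is the
   common value. *)
Definition rk : nat := (\max_(B in bases M) #|B|)%N.

Lemma card_exchange A x y :
  x \in A -> y \notin A -> #|y |: (A :\ x)| = #|A|.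
Proof.
move=> xA yA; rewrite cardsU1 !inE (negbTE yA) andbF /=.
by rewrite [RHS](cardsD1 x) xA.
Qed.

Lemma card_basis_eq A B : A \in bases M -> B \in bases M -> #|A| = #|B|.
Proof.
have le_card n : forall A B, (#|A :\: B| <= n)%N ->
    A \in bases M -> B \in bases M -> (#|A| <= #|B|)%N.
  elim: n => [|n IHn] {}A {}B leAB bA bB.
    by apply/subset_leq_card; rewrite -setD_eq0 -cards_eq0 -leqn0.
  have [/eqP|[x xAB]] := set_0Vmem (A :\: B).
    by rewrite setD_eq0; apply: subset_leq_card.
  have [y yBA bA'] := basis_exchange bA bB xAB.
  move: (xAB) (yBA); rewrite !inE => /andP[xB xA] /andP[yA yB].
  rewrite -(card_exchange xA yA); apply: IHn => //.
  have /subset_leq_card/leq_trans : (y |: (A :\ x)) :\: B \subset (A :\: B) :\ x.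
    apply/subsetP => z; rewrite !inE => /andP[zB /orP[/eqP zy|/andP[-> ->]]].
      by rewrite zy yB in zB.
    by rewrite zB.
  apply; rewrite -ltnS; apply: leq_trans leAB.
  by rewrite [in leqRHS](cardsD1 x) xAB.
by move=> bA bB; apply/eqP; rewrite eqn_leq !(le_card _ _ _ (leqnn _)).
Qed.

Lemma card_basis B : B \in bases M -> #|B| = rk.
Proof.
move=> bB; apply/eqP; rewrite eqn_leq (leq_bigmax_cond _ bB) /=.
by apply/bigmax_leqP => A bA; rewrite (card_basis_eq bA bB).
Qed.

Lemma basis_coexchange A B x :
  A \in bases M -> B \in bases M -> x \in B :\: A ->
  exists2 y, y \in A :\: B & x |: (A :\ y) \in bases M.
Proof.
move=> bA bB xBA.
pose P C := [&& C \in bases M, x \in C & A :&: B \subset C].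
have PB : P B.
  by rewrite /P bB subsetIr andbT; move: xBA; rewrite inE => /andP[].
case: (@arg_maxnP _ B P (fun C => #|C :&: A|) PB) => C /and3P[bC xC sC] maxC.
have xA : x \notin A by move: xBA; rewrite inE => /andP[].
have CDA z : z \in C -> z \notin A -> z = x.
  move=> zC zA; apply/eqP; apply: contraT => zx.
  have zCA : z \in C :\: A by rewrite inE zA.
  have [w wAC bC'] := basis_exchange bC bA zCA.
  move: wAC; rewrite inE => /andP[wC wA].
  have /maxC : P (w |: (C :\ z)).
    rewrite /P bC' !inE xC (eq_sym x z) zx orbT /=.
    apply/subsetP => u uAB; rewrite !inE (subsetP sC) // andbT.
    case: (eqVneq u z) => [uz|_]; last by rewrite orbT.
    by move: uAB; rewrite uz inE (negbTE zA).
  suff -> : (w |: (C :\ z)) :&: A = w |: (C :&: A).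
    by rewrite /= cardsU1 inE (negbTE wC) /= add1n ltnn.
  apply/setP => u; rewrite !inE.
  case: (eqVneq u w) => [->|_] /=; first by rewrite wA.
  by case: (eqVneq u z) => [->|_] //=; rewrite (negbTE zA) andbF.
have cardAC : #|A| = #|C| := card_basis_eq bA bC.
have /card_gt0P[y] : (0 < #|A :\: C|)%N.
  rewrite lt0n cards_eq0 setD_eq0; apply/negP => sAC.
  have eAC : A = C by apply/eqP; rewrite eqEcard sAC cardAC leqnn.
  by rewrite eAC xC in xA.
rewrite inE => /andP[yC yA]; exists y.
  rewrite inE yA andbT; apply: contra yC => yB.
  by apply: (subsetP sC); rewrite inE yA.
suff <- : C = x |: (A :\ y) by [].
apply/eqP; rewrite eqEcard card_exchange // cardAC leqnn andbT.
apply/subsetP => z zC; rewrite !inE; case: (boolP (z \in A)) => [zA|zA].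
  by rewrite andbT orbC; case: (eqVneq z y) => // zy; rewrite zy (negbTE yC) in zC.
by rewrite (CDA z zC zA) eqxx.
Qed.

Definition dual_bases : {set {set E}} := [set ~: B | B in bases M].

Lemma dual_basesE A : (A \in dual_bases) = (~: A \in bases M).
Proof.
apply/imsetP/idP => [[B bB ->]|bA]; first by rewrite setCK.
by exists (~: A); rewrite ?setCK.
Qed.

Lemma dual_bases_neq0 : dual_bases != set0.
Proof.
have /set0Pn[B bB] := bases_neq0 M.
by apply/set0Pn; exists (~: B); rewrite dual_basesE setCK.
Qed.

Lemma dual_basis_exchange A B : A \in dual_bases -> B \in dual_bases ->
  forall x, x \in A :\: B ->
  exists2 y, y \in B :\: A & y |: (A :\ x) \in dual_bases.
Proof.
rewrite !dual_basesE => bA bB x xAB.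
have xBA : x \in ~: B :\: ~: A by move: xAB; rewrite !inE negbK andbC.
have [y yAB byA] := basis_coexchange bA bB xBA.
exists y; first by move: yAB; rewrite !inE negbK andbC.
rewrite dual_basesE; suff -> : ~: (y |: (A :\ x)) = x |: (~: A :\ y) by [].
have yx : y != x.
  by apply/eqP => yx; move: xAB yAB; rewrite yx !inE => /andP[_ ->]; rewrite andbF.
apply/setP => z; rewrite !inE negb_or negb_and negbK.
by case: (eqVneq z x) => [->|_]; rewrite ?orbT ?andbT //= eq_sym yx.
Qed.

Definition dual_matroid : matroid E := Matroid dual_bases_neq0 dual_basis_exchange.

End MatroidTheory.

Section Algorithm.
Variables (R : realType) (E : finType).

Record instance := Instance {
  mat1 : matroid E; mat2 : matroid E;
  cost1 : E -> R; cost2 : E -> R;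
  inter_card : nat }.

Definition cost (c : E -> R) (S : {set E}) : R := \sum_(e in S) c e.

Definition feasible (I : instance) (X Y : {set E}) : Prop :=
  [/\ X \in bases (mat1 I), Y \in bases (mat2 I) & #|X :&: Y| = inter_card I].

Definition optimal (I : instance) (X Y : {set E}) : Prop :=
  feasible I X Y /\
  forall X' Y', feasible I X' Y' ->
    cost (cost1 I) X + cost (cost2 I) Y <= cost (cost1 I) X' + cost (cost2 I) Y'.

Definition unconstrained_optimal (I : instance) (X Y : {set E}) : Prop :=
  [/\ X \in bases (mat1 I), Y \in bases (mat2 I) &
   forall X' Y', X' \in bases (mat1 I) -> Y' \in bases (mat2 I) ->
    cost (cost1 I) X + cost (cost2 I) Y <= cost (cost1 I) X' + cost (cost2 I) Y'].

(* The subtraction is exact whenever inter_card I <= rk (mat1 I). *)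
Definition dual_instance (I : instance) : instance :=
  Instance (mat1 I) (dual_matroid (mat2 I))
           (cost1 I) (fun e => - cost2 I e) (rk (mat1 I) - inter_card I)%N.

Record state := State {
  solX : {set E}; solY : {set E};
  lam : R; alpha : E -> R; beta : E -> R }.

Definition initial_state (X Y : {set E}) : state :=
  State X Y 0 (fun=> 0) (fun=> 0).

Inductive colour := Red | Blue.

Definition same_colour (a b : colour) : bool :=
  match a, b with Red, Red | Blue, Blue => true | _, _ => false end.

(* Arcs carry their colour: a red and a blue arc may be parallel, and they act
   differently on (X, Y). *)
Record arc := Arc { arc_colour : colour; src : E; dst : E }.

Section Digraph.
Variables (I : instance) (s : state).
Local Notation X := (solX s).
Local Notation Y := (solY s).

Definition rcost1 (e : E) : R := cost1 I e - alpha s e.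
Definition rcost2 (e : E) : R := cost2 I e - beta s e.

Definition red_arc (e f : E) : bool :=
  [&& e \notin X, f \in X, e |: (X :\ f) \in bases (mat1 I)
    & rcost1 e == rcost1 f].

Definition blue_arc (f g : E) : bool :=
  [&& g \notin Y, f \in Y, g |: (Y :\ f) \in bases (mat2 I)
    & rcost2 g == rcost2 f].

Definition is_arc (a : arc) : bool :=
  match arc_colour a with
  | Red => red_arc (src a) (dst a)
  | Blue => blue_arc (src a) (dst a)
  end.

(* P is the list of arcs of a red-blue alternating path (no repeated vertex)
   from v to w; P = [::] is the trivial path, with v = w. *)
Definition alternating_path (v : E) (P : seq arc) (w : E) : bool :=
  [&& all is_arc P,
      sorted (fun a b => (dst a == src b)
                         && ~~ same_colour (arc_colour a) (arc_colour b)) P,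
      head v (map src P) == v,
      last v (map dst P) == w
    & uniq (v :: map dst P)].

Definition source_sink_path (P : seq arc) : Prop :=
  exists v w, [/\ v \in Y :\: X, w \in X :\: Y & alternating_path v P w].

Definition augmenting_path (P : seq arc) : Prop :=
  source_sink_path P /\
  forall P', source_sink_path P' -> (size P <= size P')%N.

Definition augmentX (P : seq arc) : {set E} :=
  let rs := [seq a <- P | same_colour (arc_colour a) Red] in
  (X :\: [set e in map dst rs]) :|: [set e in map src rs].

Definition augmentY (P : seq arc) : {set E} :=
  let bs := [seq a <- P | same_colour (arc_colour a) Blue] in
  (Y :\: [set e in map src bs]) :|: [set e in map dst bs].

Definition reachable : {set E} :=
  [set w | `[< exists v P, v \in Y :\: X /\ alternating_path v P w >]].

Definition delta1 : \bar R :=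
  \big[mine/+oo%E]_(p : E * E | [&& p.1 \in reachable :\: X,
       p.2 \in X :\: reachable & p.1 |: (X :\ p.2) \in bases (mat1 I)])
    (rcost1 p.1 - rcost1 p.2)%:E.

Definition delta2 : \bar R :=
  \big[mine/+oo%E]_(p : E * E | [&& p.1 \notin Y :|: reachable,
       p.2 \in Y :&: reachable & p.1 |: (Y :\ p.2) \in bases (mat2 I)])
    (rcost2 p.1 - rcost2 p.2)%:E.

Definition step_length : \bar R := mine delta1 delta2.

Definition primal_augmentation (P : seq arc) : state :=
  State (augmentX P) (augmentY P) (lam s) (alpha s) (beta s).

Definition dual_augmentation (d : R) : state :=
  State X Y (lam s + d)
    (fun e => if e \in reachable then alpha s e + d else alpha s e)
    (fun e => if e \in reachable then beta s e else beta s e + d).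

End Digraph.

(* Control states of the algorithm:
   - Begin I X Y: about to run on I, with unconstrained optimum (X, Y) at hand;
   - While I s: about to test the guard of the while loop;
   - InDual c: waiting for the run c on the dual instance. *)
Inductive config :=
  | Begin of instance & {set E} & {set E}
  | While of instance & state
  | InDual of config
  | Returned of {set E} & {set E}
  | InfeasibleInstance.

(* One step; the boolean label is true exactly for primal and dual
   augmentations. The choice of the augmenting path is nondeterministic. *)
Inductive step : config -> bool -> config -> Prop :=
  | step_return I X Y :
      #|X :&: Y| = inter_card I ->
      step (Begin I X Y) false (Returned X Y)
  | step_dualize I X Y :
      (inter_card I < #|X :&: Y|)%N ->
      step (Begin I X Y) false (InDual (Begin (dual_instance I) X (~: Y)))
  | step_init I X Y :
      (#|X :&: Y| < inter_card I)%N ->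
      step (Begin I X Y) false (While I (initial_state X Y))
  | step_primal I s P :
      (#|solX s :&: solY s| < inter_card I)%N ->
      augmenting_path I s P ->
      step (While I s) true (While I (primal_augmentation s P))
  | step_dual I s d :
      (#|solX s :&: solY s| < inter_card I)%N ->
      (forall P, ~ augmenting_path I s P) ->
      step_length I s = d%:E ->
      step (While I s) true (While I (dual_augmentation I s d))
  | step_infeasible I s :
      (#|solX s :&: solY s| < inter_card I)%N ->
      (forall P, ~ augmenting_path I s P) ->
      step_length I s = +oo%E ->
      step (While I s) false InfeasibleInstance
  | step_exit I s :
      (inter_card I <= #|solX s :&: solY s|)%N ->
      step (While I s) false (Returned (solX s) (solY s))
  | step_in_dual c b c' :
      step c b c' -> step (InDual c) b (InDual c')
  | step_dual_returned X Z :
      step (InDual (Returned X Z)) false (Returned X (~: Z))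
  | step_dual_infeasible :
      step (InDual InfeasibleInstance) false InfeasibleInstance.

(* run c tr n: tr lists the configurations of a (possibly unfinished) execution
   from c, both ends included, and n is its number of augmentations. *)
Inductive run : config -> seq config -> nat -> Prop :=
  | run_stop c : run c [:: c] 0%N
  | run_step c b c' tr n :
      step c b c' -> run c' tr n -> run c (c :: tr) (b + n)%N.

Definition halted (c : config) : Prop := forall b c', ~ step c b c'.

Definition complete_run (c : config) (tr : seq config) (n : nat) : Prop :=
  run c tr n /\ halted (last c tr).

Definition terminates (c : config) : Prop :=
  Acc (fun c2 c1 => exists b, step c1 b c2) c.

Definition correct_answer (I : instance) (c : config) : Prop :=
  match c with
  | Returned X Y => optimal I X Y
  | InfeasibleInstance => forall X Y, ~ feasible I X Y
  | _ => False
  end.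

(* The current pair, read back in terms of the instance the algorithm was
   called on. *)
Fixpoint current_pair (c : config) : option ({set E} * {set E}) :=
  match c with
  | Begin _ X Y | Returned X Y => Some (X, Y)
  | While _ s => Some (solX s, solY s)
  | InDual c' => omap (fun p => (p.1, ~: p.2)) (current_pair c')
  | InfeasibleInstance => None
  end.

End Algorithm.

Arguments Returned {R E} _ _.
Arguments InfeasibleInstance {R E}.

(* Main.v *)
Require Import Defs.
From mathcomp Require Import all_boot all_order all_algebra.
From mathcomp Require Import boolp reals constructive_ereal.
From mathcomp Require Import zify lra.

(** Why the algorithm is correct and fast.

    Every pair visited by the while loop carries a certificate that it is optimal
    for its own intersection size: potentials alpha, beta >= 0 with
    alpha + beta = lambda everywhere, X a basis of minimum weight for c1 - alpha,
    Y a basis of minimum weight for c2 - beta, alpha = 0 on X \ Y and beta = 0 on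
    Y \ X.  For arbitrary bases X', Y' the potentials cost
    alpha(X') + beta(Y') >= lambda |X' n Y'|, with equality for (X, Y); subtracting
    gives weak duality ([certificate_optimal]).

    A primal augmentation keeps the certificate.  The bases of minimum weight of
    a matroid are again the bases of a matroid ([optimal_matroid], by symmetric
    exchange), and the arcs of one colour are exactly the single exchanges of
    that matroid.  A shortest path has no shortcut, so its red arcs (e_i, f_i)
    satisfy: e_i cannot replace f_j for i < j.  Under this triangularity the
    exchanges can be carried out one after the other ([serial_exchange]); the blue
    arcs are handled in the reverse order.  The change of the indicator of X minus
    the indicator of Y telescopes along the path to source minus sink, so X \ Y
    loses the sink, Y \ X loses the source, and the intersection grows by exactly
    one ([augment_differences]).

    A dual augmentation keeps the certificate because the step length is the
    largest change of the potentials under which no single exchange becomes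
    profitable, and local optimality of a basis implies global optimality
    ([locally_optimal]).  If the step length is infinite, no exchange leaves or
    enters the reachable set R in the relevant direction, so |X' n R| and
    |Y' \ R| are maximal at X and Y; since R contains Y \ X and misses X \ Y, no
    pair of bases intersects in more elements ([no_crossing_card]).

    The count: a finite dual step needs R to be nonempty, keeps all of R reachable
    and makes at least one more vertex reachable ([reachable_dual]).  Hence at most
    |E| augmentations are spent on each unit of intersection, which the potential
    function [budget] records.  If the unconstrained optimum intersects in too many
    elements, replacing M2 by its dual complements Y and reverses the direction, so
    both cases follow from one invariant, [sound].  Since the intersection size
    moves by at most one in each step, the run to 0 and the run to K together meet
    every feasible size, and they take at most K |E| <= |E|^2 augmentations in
    total. *)

Set Implicit Arguments.
Unset Strict Implicit.
Unset Printing Implicit Defensive.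

Import Order.TTheory GRing.Theory Num.Theory.

Local Open Scope ring_scope.

(** * Basis exchange in a matroid *)
Section Exchange.
Variables (E : finType) (M : matroid E).
Implicit Types (A B X : {set E}) (e f g h x y : E).

Definition exchangeable X e f :=
  [&& e \notin X, f \in X & e |: (X :\ f) \in bases M].

Lemma cardsD_exchange A B x y :
  y \in B -> x \notin B -> x \in A -> y \notin A ->
  (#|(y |: (A :\ x)) :\: B| < #|A :\: B|)%N.
Proof.
move=> yB xB xA yA; apply/proper_card/properP; split.
  apply/subsetP => z; rewrite !inE => /andP[zB].
  case: eqVneq => [zy|_] /=; first by rewrite zy yB in zB.
  by case/andP=> _ ->; rewrite zB.
exists x; first by rewrite !inE xB xA.
by rewrite !inE eqxx xB /= orbF; apply: contra yA => /eqP <-.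
Qed.

(** In terms of rank: if no single exchange increases [X :&: U], then [X]
    contains a basis of [U].  A counterexample [B] as close to [X] as possible
    has [B :\: X] inside [U], for otherwise an element of [B :\: X] outside [U]
    could be traded for one of [X]; removing from [X] an element outside [U]
    then brings in an element of [U]. *)
Lemma no_exchange_card X (U : {set E}) B :
  X \in bases M -> B \in bases M ->
  (forall e f, exchangeable X e f -> e \in U -> f \in U) ->
  (#|B :&: U| <= #|X :&: U|)%N.
Proof.
move=> bX bB noX; have [n] := ubnP #|B :\: X|; elim: n => // n IH in B bB *.
rewrite ltnS => leBX.
case: (boolP (B :\: X \subset U)) => [sub|/subsetPn[x xBX xU]]; last first.
  have [y yXB bB'] := basis_exchange bB bX xBX.
  have [[xX xB] [yX yB]] : (x \notin X /\ x \in B) /\ (y \in X /\ y \notin B).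
    by move: xBX yXB; rewrite !inE => /andP[-> ->] /andP[-> ->].
  apply: leq_trans (IH _ bB' _); last first.
    by apply: leq_trans leBX; apply: cardsD_exchange.
  apply/subset_leq_card/subsetP => z; rewrite !inE => /andP[zB zU].
  rewrite zB zU !andbT; case: (eqVneq z x) => [zx|_]; last by rewrite orbT.
  by rewrite -zx zU in xU.
rewrite leqNgt; apply/negP => lt.
have /subsetPn[f fXB fU] : ~~ (X :\: B \subset U).
  apply: contraL lt => sub'; rewrite -leqNgt.
  have : (#|X :\: U| <= #|B :\: U|)%N.
    apply/subset_leq_card/subsetP => z; rewrite !inE => /andP[zU zX].
    rewrite zU /=; apply: contraR zU => zB.
    by apply: (subsetP sub'); rewrite inE zB.
  have := cardsID U X; have := cardsID U B.
  by have := card_basis_eq bX bB; lia.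
have [e eBX bX'] := basis_exchange bX bB fXB.
move: (fXB) (eBX); rewrite !inE => /andP[fB fX] /andP[eX eB].
case/negP: fU; apply: (noX e); first by rewrite /exchangeable eX fX.
exact: (subsetP sub).
Qed.

(** If no [y] works, let [S] be the fundamental circuit of [x] over [B] without
    [x].  Then [S] is a maximal independent subset of [x |: S], while [A :\ x] is
    a maximal one of [(A :\ x) :|: S], which therefore contains no basis.  But a
    basis that contains [S] and otherwise lies in [A] must avoid [x], by the
    first fact, and so lies in [(A :\ x) :|: S]. *)
Lemma symmetric_exchange A B x :
  A \in bases M -> B \in bases M -> x \in A :\: B ->
  exists2 y, y \in B :\: A &
    y |: (A :\ x) \in bases M /\ x |: (B :\ y) \in bases M.
Proof.
move=> bA bB xAB; have /andP[xB xA] : (x \notin B) && (x \in A).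
  by move: xAB; rewrite inE.
apply: contrapT => noy.
have {}noy y : y \in B -> y \notin A -> x |: (B :\ y) \in bases M ->
    y |: (A :\ x) \notin bases M.
  move=> yB yA bBx; apply/negP => bAy; apply: noy.
  by exists y; rewrite // inE yA yB.
pose S := [set y in B | x |: (B :\ y) \in bases M].
have leS D : D \in bases M -> (#|D :&: (x |: S)| <= #|S|)%N.
  move=> bD; apply: leq_trans (no_exchange_card (X := B) bB bD _) _.
    move=> e f /and3P[eB fB bBf]; rewrite !inE => /orP[/eqP ex|/andP[eB' _]].
      by rewrite -ex fB bBf orbT.
    by rewrite eB' in eB.
  apply/subset_leq_card/subsetP => z; rewrite !inE => /andP[zB].
  by case/orP=> [/eqP zx|//]; rewrite -zx zB in xB.
have leA D : D \in bases M -> (#|D :&: ((A :\ x) :|: S)| <= #|A :\ x|)%N.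
  move=> bD; apply: leq_trans (no_exchange_card (X := A) bA bD _) _.
    move=> e f /and3P[eA fA bAf]; rewrite !inE fA andbT.
    rewrite (negbTE eA) andbF /= => /andP[eB bBe].
    case: eqVneq => //= fx; have := noy _ eB eA bBe.
    by rewrite -fx bAf.
  apply/subset_leq_card/subsetP => z; rewrite !inE => /andP[zA].
  rewrite zA andbT; case/orP=> [//|/andP[zB _]].
  by apply: contraTneq zB => ->.
(* Moving [B] towards [A] while keeping [S] gives a basis inside [A :|: S]. *)
pose P D := (D \in bases M) && (S \subset D).
have PB : P B by rewrite /P bB; apply/subsetP => z; rewrite inE => /andP[].
case: (@arg_minnP _ B P (fun D => #|D :\: A|) PB) => D /andP[bD sSD] minD.
have sD z : z \in D -> z \notin A -> z \in S.
  move=> zD zA; apply: contraT => zS.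
  have zDA : z \in D :\: A by rewrite inE zA.
  have [a aAD bD'] := basis_exchange bD bA zDA.
  move: aAD; rewrite inE => /andP[aD aA].
  suff /minD : P (a |: (D :\ z)) by rewrite leqNgt cardsD_exchange.
  rewrite /P bD' /=; apply/subsetP => u uS; rewrite !inE (subsetP sSD) // andbT.
  by case: (eqVneq u z) => [uz|_]; rewrite ?orbT //; rewrite -uz uS in zS.
have xS : x \notin S by rewrite inE (negbTE xB).
have xD : x \in D.
  apply: contraT => xD; have := leA _ bD; rewrite leqNgt => /negP[].
  have -> : D :&: ((A :\ x) :|: S) = D.
    apply/setIidPl/subsetP => z zD; rewrite !inE.
    have [zA|zA] := boolP (z \in A).
      by rewrite andbT; case: eqVneq => //= zx; rewrite -zx zD in xD.
    by have := sD _ zD zA; rewrite inE => ->; rewrite orbT.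
  by rewrite (card_basis_eq bD bA) (cardsD1 x A) xA.
have := leS _ bD; rewrite leqNgt => /negP[].
have -> : D :&: (x |: S) = x |: S.
  apply/setIidPr/subsetP => z; rewrite in_setU1 => /orP[/eqP -> //|].
  exact: (subsetP sSD).
by rewrite cardsU1 xS.
Qed.

(** The fundamental circuit of [e] may change when [g] is replaced by [h], but
    not in its incidence with an [f] that avoids the circuit of [h]: in either
    direction, basis exchange between the two bases at hand leaves two possible
    elements to drop, and one of them would produce [h |: (X :\ f)]. *)
Lemma exchangeable_stable X e f g h :
  X \in bases M -> exchangeable X h g -> ~~ exchangeable X h f ->
  e \notin X -> e != h -> f \in X -> f != g ->
  exchangeable (h |: (X :\ g)) e f = exchangeable X e f.
Proof.
move=> bX /and3P[hX gX bX1]; rewrite /exchangeable hX /= => nhf eX eh fX fg.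
move: nhf; rewrite fX /= => nhf.
rewrite !inE (negbTE eX) fX fg (negbTE eh) andbF orbT /=.
have F := (eqxx, negbTE eX, fX, gX, negbTE hX, negbTE eh, negbTE fg,
  eq_sym h e, eq_sym g f, andbF, andbT, orbT, orbF).
have hf : h != f by apply: contraNneq hX => ->.
have hg : h != g by apply: contraNneq hX => ->.
have ef : e != f by apply: contraNneq eX => ->.
have eg : e != g by apply: contraNneq eX => ->.
have {}F := (F, negbTE hf, negbTE hg, negbTE ef, negbTE eg,
  eq_sym f h, eq_sym g h, eq_sym f e, eq_sym g e).
have eq_basis A B : A = B -> A \in bases M -> B \in bases M by move=> ->.
apply/idP/idP => [bD|bA].
- have gD : g \in X :\: (e |: ((h |: (X :\ g)) :\ f)) by rewrite !inE !F.
  have [y yD bD'] := basis_coexchange bD bX gD.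
  have /orP[/eqP yE|/eqP yE] : (y == e) || (y == h).
    by move: yD; rewrite !inE; case: (y == e); case: (y == h);
       case: (y \in X); rewrite !F.
  + case/negP: nhf; move: bD'; rewrite yE => /eq_basis; apply; apply/setP => u.
    rewrite !inE; case: (eqVneq u g) => [->|_]; rewrite ?F //.
    case: (eqVneq u e) => [->|_]; rewrite ?F //=.
    by case: eqVneq => [->|_]; rewrite ?F.
  + move: bD'; rewrite yE => /eq_basis; apply; apply/setP => u.
    rewrite !inE; case: (eqVneq u g) => [->|_]; rewrite ?F //.
    by case: (eqVneq u h) => [->|_]; rewrite ?F.
- have hD : h \in (h |: (X :\ g)) :\: (e |: (X :\ f)) by rewrite !inE !F.
  have [y yD bD'] := basis_coexchange bA bX1 hD.
  have /orP[/eqP yE|/eqP yE] : (y == e) || (y == g).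
    by move: yD; rewrite !inE; case: (y == e); case: (y == g);
       case: (y \in X); rewrite ?F //; case: (y == f); case: (y == h).
  + case/negP: nhf; move: bD'; rewrite yE => /eq_basis; apply; apply/setP => u.
    by rewrite !inE; case: (eqVneq u e) => [->|_]; rewrite ?F.
  + move: bD'; rewrite yE => /eq_basis; apply; apply/setP => u.
    rewrite !inE; case: (eqVneq u h) => [->|_]; rewrite ?F //=.
    by case: (eqVneq u g) => [->|_]; rewrite ?F.
Qed.

Definition exchange_all X (s : seq (E * E)) :=
  (X :\: [set f in map snd s]) :|: [set e in map fst s].

(** Performing the first exchange of the list preserves the hypotheses for the
    remaining ones, thanks to [exchangeable_stable], so the simultaneous exchange
    is a sequence of single ones.  Distinctness of the entries comes for free: a
    repeated element would violate the triangularity.  The membership formula is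
    what telescopes along a path. *)
Lemma serial_exchange X (s : seq (E * E)) :
  X \in bases M -> all (fun p => exchangeable X p.1 p.2) s ->
  pairwise (fun p q => ~~ exchangeable X p.1 q.2) s ->
  exchange_all X s \in bases M /\
  forall u, (u \in exchange_all X s)%:R =
    (u \in X)%:R + \sum_(p <- s) ((u == p.1)%:R - (u == p.2)%:R) :> int.
Proof.
elim: s X => [|[h g] s IH] X bX /=.
  have -> : exchange_all X [::] = X by apply/setP => u; rewrite !inE orbF.
  by split=> // u; rewrite big_nil addr0.
case/andP=> ex0 ex_s /andP[no0 no_s].
have [hX gX bX1] := and3P ex0.
have e_s : {in s &, forall p q,
    exchangeable (h |: (X :\ g)) p.1 q.2 = exchangeable X p.1 q.2}.
  move=> p q ps qs; have := allP ex_s _ ps; have := allP ex_s _ qs.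
  have := allP no0 _ ps; have := allP no0 _ qs => /=.
  move=> noq nop /and3P[_ qX _] exp; have [pX _ _] := and3P exp.
  apply: exchangeable_stable => //; first by apply: contraNneq nop => <-.
  by apply: contraNneq noq => ->.
have [||bs es] := IH _ bX1.
- by apply/allP => p ps; rewrite e_s //; apply: (allP ex_s).
- rewrite (eq_in_pairwise (P := mem s)
    (r' := fun p q => ~~ exchangeable X p.1 q.2)) //.
  by move=> p q ps qs; rewrite e_s.
have -> : exchange_all X ((h, g) :: s) = exchange_all (h |: (X :\ g)) s.
  apply/setP => u; rewrite !inE /=.
  case: (eqVneq u h) => [->|_] /=.
    rewrite orbT; case: (boolP (h \in map snd s)) => [/mapP[p ps hp]|//].
    by have /and3P[_ + _] := allP ex_s _ ps; rewrite -hp (negbTE hX).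
  by rewrite negb_or; case: (u == g); rewrite ?andbF.
split=> // u; rewrite es big_cons /= addrA; congr (_ + _).
rewrite !inE; case: (eqVneq u h) => [->|_] /=.
  have /negbTE-> : h != g by apply: contraNneq hX => ->.
  by rewrite (negbTE hX); lia.
by case: (eqVneq u g) => [->|_] /=; rewrite ?gX; lia.
Qed.

End Exchange.

(** * Bases of minimum weight *)
Section Weighted.
Variables (R : realType) (E : finType) (M : matroid E).
Implicit Types (w : E -> R) (A B X : {set E}).

Lemma cost_exchange w X e f : e \notin X -> f \in X ->
  cost w (e |: (X :\ f)) = cost w X + w e - w f.
Proof.
move=> eX fX; rewrite /cost big_setU1 ?inE ?(negbTE eX) ?andbF //=.
by rewrite [in RHS](big_setD1 f) //=; lra.
Qed.

Definition optimal_bases w : {set {set E}} :=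
  [set B in bases M | [forall B' in bases M, cost w B <= cost w B']].

Lemma optimal_basesP w B : reflect
  (B \in bases M /\ forall B', B' \in bases M -> cost w B <= cost w B')
  (B \in optimal_bases w).
Proof. by rewrite inE; apply: (iffP andP) => -[bB /forall_inP]. Qed.

(** Let [z] have maximum weight in the symmetric difference of [X] and a
    competitor [B].  If [z] lies in [B], trading it for an element of [X] does not
    make [B] more expensive and brings it closer to [X].  If [z] lies in [X],
    local optimality forces the element of [B] that can replace it to have the
    same weight, and that element takes the role of [z]. *)
Lemma locally_optimal w X : X \in bases M ->
  (forall e f, exchangeable M X e f -> w f <= w e) -> X \in optimal_bases w.
Proof.
move=> bX loc; apply/optimal_basesP; split=> // B bB.
have [n] := ubnP #|B :\: X|; elim: n => // n IH in B bB *; rewrite ltnS => leB.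
have [/eqP|[z0 z0BX]] := set_0Vmem (B :\: X).
  rewrite setD_eq0 => sBX; suff -> : X = B by [].
  by apply/eqP; rewrite eq_sym eqEcard sBX (card_basis_eq bX bB) leqnn.
pose D := (B :\: X) :|: (X :\: B).
have z0D : z0 \in D by rewrite in_setU z0BX.
case: (@arg_maxP _ _ _ z0 (mem D) w z0D) => z zD maxz.
have {}maxz u : u \in D -> w u <= w z by exact: maxz.
have {}zD : z \in D by exact: zD.
have down z' : z' \in B :\: X -> w z' = w z -> cost w X <= cost w B.
  move=> zBX wz; have [y yXB bB'] := basis_exchange bB bX zBX.
  have /andP[zX zB] : (z' \notin X) && (z' \in B) by move: zBX; rewrite inE.
  have /andP[yB yX] : (y \notin B) && (y \in X) by move: yXB; rewrite inE.
  have := IH _ bB'; rewrite cost_exchange // => /(_ _)/le_trans; apply.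
    by apply: leq_trans leB; apply: cardsD_exchange.
  have : w y <= w z by apply: maxz; rewrite in_setU yXB orbT.
  by rewrite wz; lra.
move: (zD); rewrite in_setU => /orP[zBX|zXB]; first exact: down zBX _.
have [e eBX bX'] := basis_exchange bX bB zXB.
apply: (down e) => //; apply/eqP; rewrite eq_le maxz ?in_setU ?eBX //=.
apply: loc; move: zXB eBX; rewrite !inE => /andP[_ zX] /andP[eX _].
by rewrite /exchangeable eX zX.
Qed.

Lemma optimal_bases_neq0 w : optimal_bases w != set0.
Proof.
have /set0Pn[B0 bB0] := bases_neq0 M.
case: (@arg_minP _ _ _ B0 (mem (bases M)) (cost w) bB0) => B bB minB.
by apply/set0Pn; exists B; apply/optimal_basesP.
Qed.

(** The two bases produced by a symmetric exchange have the same total weight as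
    the two optimal bases one started from, so both are optimal. *)
Lemma optimal_basis_exchange w A B :
  A \in optimal_bases w -> B \in optimal_bases w ->
  forall x, x \in A :\: B ->
  exists2 y, y \in B :\: A & y |: (A :\ x) \in optimal_bases w.
Proof.
move=> /optimal_basesP[bA oA] /optimal_basesP[bB oB] x xAB.
have [y yBA [bA' bB']] := symmetric_exchange bA bB xAB.
exists y => //; apply/optimal_basesP; split=> // C bC.
have := oB _ bB'; have := oA _ bC.
move: xAB yBA; rewrite !inE => /andP[xB xA] /andP[yA yB].
by rewrite !cost_exchange //; lra.
Qed.

Lemma optimal_exchange w X e f :
  X \in optimal_bases w -> exchangeable M X e f -> w f <= w e.
Proof.
move=> /optimal_basesP[_ oX] /and3P[eX fX /oX].
by rewrite cost_exchange //; lra.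
Qed.

Definition optimal_matroid w : matroid E :=
  Matroid (optimal_bases_neq0 w) (@optimal_basis_exchange w).

Lemma tight_exchangeable w X e f : X \in optimal_bases w ->
  exchangeable (optimal_matroid w) X e f = exchangeable M X e f && (w e == w f).
Proof.
move=> /optimal_basesP[bX oX]; rewrite /exchangeable -!andbA.
have [//|eX] := boolP (e \in X); have [fX|//] := boolP (f \in X) => /=.
apply/optimal_basesP/andP => [[bX' oX']|[bX' /eqP wef]]; last first.
  by split=> // B bB; rewrite cost_exchange // wef addrK oX.
split=> //; have := oX _ bX'; have := oX' _ bX; rewrite cost_exchange //.
by move=> le1 le2; apply/eqP; lra.
Qed.

End Weighted.


(** * Alternating paths and the primal augmentation *)
Lemma pairwise_split (T : Type) (r : rel T) (s : seq T) :
  (forall s1 a s2 b s3, s = s1 ++ a :: s2 ++ b :: s3 -> r a b) -> pairwise r s.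
Proof.
elim: s => //= a s IH H; apply/andP; split; last first.
  by apply: IH => s1 b s2 c s3 e; apply: (H (a :: s1) b s2 c s3); rewrite e.
have {}H s2 b s3 : s = s2 ++ b :: s3 -> r a b.
  by move=> e; apply: (H [::] a s2 b s3); rewrite e.
elim: s {IH} => //= b s IH in H *; rewrite (H [::] b s) //=.
by apply: IH => s2 c s3 e; apply: (H (b :: s2) c s3); rewrite e.
Qed.

Lemma pairwise_rev (T : Type) (r : rel T) (s : seq T) :
  pairwise r (rev s) = pairwise (fun x y => r y x) s.
Proof. by elim: s => //= a s IH; rewrite rev_cons pairwise_rcons IH all_rev. Qed.

Section Digraph.
Variables (R : realType) (E : finType) (I : instance R E) (s : state R E).
Implicit Types (P : seq (Defs.arc E)) (a b : Defs.arc E) (u v w : E).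

Local Notation X := (solX s).
Local Notation Y := (solY s).
Local Notation M1 := (mat1 I).
Local Notation M2 := (mat2 I).
Local Notation w1 := (rcost1 I s).
Local Notation w2 := (rcost2 I s).
Local Notation apath := (alternating_path I s).
Local Notation reach := (reachable I s).

Lemma red_arcE e f :
  red_arc I s e f = exchangeable M1 X e f && (w1 e == w1 f).
Proof. by rewrite /red_arc /exchangeable -!andbA. Qed.

Lemma blue_arcE f g :
  blue_arc I s f g = exchangeable M2 Y g f && (w2 g == w2 f).
Proof. by rewrite /blue_arc /exchangeable -!andbA. Qed.

(** Red arcs run from outside [X] into [X], blue arcs from [Y] to outside [Y], so
    two arcs of the same colour never follow each other: alternation is
    automatic for walks in the digraph. *)
Lemma consecutive_colours a b : is_arc I s a -> is_arc I s b -> dst a = src b ->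
  ~~ same_colour (arc_colour a) (arc_colour b).
Proof.
rewrite /is_arc; case: a b => [[] a a'] [[] b b'] //= + + ab; rewrite -{}ab.
  by case/and4P=> _ aX _ _ /and4P[]; rewrite aX.
by case/and4P=> aY _ _ _ /and4P[_]; rewrite (negbTE aY).
Qed.

Lemma path_rcons v P a w : apath v (rcons P a) w =
  [&& apath v P (src a), is_arc I s a, dst a == w &
      dst a \notin v :: map (@dst E) P].
Proof.
rewrite /alternating_path all_rcons !map_rcons last_rcons -rcons_cons rcons_uniq.
case: P => [|b P] /=.
  rewrite eqxx !andbT (eq_sym v) /=.
  by case: (src a == v); case: (is_arc I s a); rewrite ?andbF.
rewrite rcons_path last_map.
have [ar|_] := boolP (is_arc I s a); last by rewrite !andbF.
have [alP|_] := boolP (is_arc I s b && all (is_arc I s) P); last by [].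
have [/eqP lb|_] := boolP (dst (last b P) == src a); last by rewrite !andbF.
have -> : ~~ same_colour (arc_colour (last b P)) (arc_colour a).
  apply: consecutive_colours => //; move: alP; rewrite -[_ && _]/(all _ (b :: P)).
  by rewrite lastI all_rcons => /andP[].
by case: (path _ b P) (src b == v) (dst a == w) (v \notin _)
  (dst b \notin _) (dst a \notin _) (uniq _) => [] [] [] [] [] [] [].
Qed.

Lemma path_nil v w : apath v [::] w = (v == w).
Proof. by rewrite /alternating_path /= eqxx andbT. Qed.

Lemma reachableP w :
  reflect (exists v P, v \in Y :\: X /\ apath v P w) (w \in reach).
Proof. by rewrite inE; apply: asboolP. Qed.

Lemma path_reachable v P w : v \in Y :\: X -> apath v P w ->
  all (fun a => (src a \in reach) && (dst a \in reach)) P /\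
  {subset v :: map (@dst E) P <= reach}.
Proof.
move=> vYX; elim/last_ind: P w => [|P a IH] w.
  move=> _; split=> // u; rewrite inE => /eqP ->; apply/reachableP.
  by exists v, [::]; rewrite path_nil.
move=> Pw; have wR : w \in reach by apply/reachableP; exists v, (rcons P a).
move: Pw; rewrite path_rcons => /and4P[Pa _ /eqP aw _].
have aR : src a \in reach by apply/reachableP; exists v, P.
have [alP sub] := IH _ Pa; rewrite all_rcons aR aw wR; split=> // u.
by rewrite map_rcons -rcons_cons mem_rcons inE aw => /predU1P[->|/sub].
Qed.

Lemma reachable_arc a : is_arc I s a -> src a \in reach -> dst a \in reach.
Proof.
move=> ar /reachableP[v [P [vYX Pa]]].
have [/(path_reachable vYX Pa).2 //|aP] := boolP (dst a \in v :: map (@dst E) P).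
by apply/reachableP; exists v, (rcons P a); rewrite path_rcons Pa ar eqxx aP.
Qed.

Lemma source_reachable : Y :\: X \subset reach.
Proof.
by apply/subsetP => v vYX; apply/reachableP; exists v, [::]; rewrite path_nil.
Qed.

Lemma augmenting_path_exists P :
  source_sink_path I s P -> exists P', augmenting_path I s P'.
Proof.
have [n] := ubnP (size P); elim: n P => // n IH P; rewrite ltnS => leP ssP.
case: (EM (exists P', source_sink_path I s P' /\ (size P' < size P)%N)).
  by case=> P' [ssP' ltP']; apply: IH ssP'; apply: leq_trans leP.
move=> no; exists P; split=> // P' ssP'; rewrite leqNgt; apply/negP => lt.
by apply: no; exists P'.
Qed.

Lemma sink_unreachable : (forall P, ~ augmenting_path I s P) ->
  forall w, w \in X :\: Y -> w \notin reach.
Proof.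
move=> no w wXY; apply/negP => /reachableP[v [P [vYX Pw]]].
have [P' /no //] : exists P', augmenting_path I s P'.
by apply: augmenting_path_exists (P) _; exists v, w.
Qed.

Lemma path_telescope v P w u : apath v P w ->
  \sum_(a <- P) ((u == src a)%:R - (u == dst a)%:R) =
  (u == v)%:R - (u == w)%:R :> int.
Proof.
elim/last_ind: P w => [|P a IH] w.
  by rewrite path_nil => /eqP ->; rewrite big_nil subrr.
rewrite path_rcons big_rcons /= => /and4P[/IH -> _ /eqP -> _]; lia.
Qed.

(** Replacing the segment from [a] to [b] by the single arc [c] would leave an
    alternating path that is strictly shorter. *)
Lemma no_shortcut P1 a P2 b P3 c :
  augmenting_path I s (P1 ++ a :: P2 ++ b :: P3) ->
  src c = src a -> dst c = dst b ->
  arc_colour c = arc_colour a -> arc_colour c = arc_colour b ->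
  ~~ is_arc I s c.
Proof.
case=> [[v [w [vYX wXY Pw]]]] shortest ca cb cola colb; apply/negP => arc_c.
have /shortest : source_sink_path I s (P1 ++ c :: P3).
  exists v, w; split=> //; move: Pw; rewrite /alternating_path.
  case/and5P; rewrite !all_cat /= all_cat /= arc_c.
  case/and4P=> -> _ _ /andP[_ ->] so he la un /=.
  apply/and4P; split.
  - move: so; rewrite !sorted_cat_cons cat_path /= => /andP[soa /and3P[_ _ sob]].
    apply/andP; split.
      case: {+}P1 soa => //= p P1'; rewrite !rcons_path => /andP[->] /=.
      by rewrite ca cola.
    by case: {+}P3 sob => //= p P3'; rewrite cb colb.
  - by case: {+}P1 he => //=; rewrite ca.
  - move: la; rewrite !map_cat /= !last_cat /= map_cat /= last_cat /=.
    by rewrite cb.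
  - move: un; rewrite -!cons_uniq; apply: subseq_uniq.
    rewrite /= eqxx !map_cat /= map_cat /= cb.
    by apply: cat_subseq => //; rewrite -cat_cons; exact: suffix_subseq.
by rewrite !size_cat /= size_cat /=; lia.
Qed.

Local Notation red a := (same_colour (arc_colour a) Red).
Local Notation blue a := (same_colour (arc_colour a) Blue).

Lemma augmenting_arcs P : augmenting_path I s P -> all (is_arc I s) P.
Proof. by case=> -[v [w [_ _ /and5P[]]]]. Qed.

(** Red arcs are the exchanges of the matroid of optimal bases, and along a
    shortest path the absence of red shortcuts is the triangularity that
    [serial_exchange] asks for. *)
Lemma augmentX_optimal P :
  X \in optimal_bases M1 w1 -> augmenting_path I s P ->
  augmentX s P \in optimal_bases M1 w1 /\
  forall u, (u \in augmentX s P)%:R = (u \in X)%:R +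
    \sum_(a <- P | red a) ((u == src a)%:R - (u == dst a)%:R) :> int.
Proof.
move=> oX augP; pose pair a := (src a, dst a).
pose rs := [seq a <- P | red a].
have -> : augmentX s P = exchange_all X (map pair rs).
  by rewrite /augmentX /exchange_all -!map_comp.
have redE e f : exchangeable (optimal_matroid M1 w1) X e f = red_arc I s e f.
  by rewrite tight_exchangeable // red_arcE.
have [|||oX' eX'] :=
  @serial_exchange _ (optimal_matroid M1 w1) X (map pair rs).
- exact: oX.
- rewrite all_map all_filter; apply: sub_all (augmenting_arcs augP).
  by move=> -[[] e f] //=; rewrite redE.
- rewrite pairwise_map.
  suff /(pairwise_filter (fun a => red a)) : pairwise
      (fun a b => red a && red b ==> ~~ red_arc I s (src a) (dst b)) P.
    apply: sub_in_pairwise (filter_all _ _) => a b /= ra rb.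
    have {}ra : red a := ra; have {}rb : red b := rb.
    by rewrite redE ra rb.
  apply: pairwise_split => P1 a P2 b P3 eP; apply/implyP => /andP[ra rb].
  rewrite eP in augP.
  apply: (no_shortcut (c := Arc Red (src a) (dst b)) augP) => //=.
    by case: (arc_colour a) ra.
  by case: (arc_colour b) rb.
- by split=> // u; rewrite eX' big_map big_filter.
Qed.

(** A blue arc leaves the element that is dropped and enters the one that is
    added, so the shortcuts are excluded in the opposite order and the exchanges
    are performed from the end of the path. *)
Lemma augmentY_optimal P :
  Y \in optimal_bases M2 w2 -> augmenting_path I s P ->
  augmentY s P \in optimal_bases M2 w2 /\
  forall u, (u \in augmentY s P)%:R = (u \in Y)%:R -
    \sum_(a <- P | ~~ red a) ((u == src a)%:R - (u == dst a)%:R) :> int.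
Proof.
move=> oY augP; pose pair a := (dst a, src a).
pose bs := [seq a <- P | blue a].
have -> : augmentY s P = exchange_all Y (rev (map pair bs)).
  rewrite /augmentY /exchange_all !map_rev -!map_comp.
  by apply/setP => u; rewrite !inE !mem_rev.
have blueE f g : exchangeable (optimal_matroid M2 w2) Y g f = blue_arc I s f g.
  by rewrite tight_exchangeable // blue_arcE.
have [|||oY' eY'] :=
  @serial_exchange _ (optimal_matroid M2 w2) Y (rev (map pair bs)).
- exact: oY.
- rewrite all_rev all_map all_filter; apply: sub_all (augmenting_arcs augP).
  by move=> -[[] e f] //=; rewrite blueE.
- rewrite pairwise_rev pairwise_map.
  suff /(pairwise_filter (fun a => blue a)) : pairwise
      (fun a b => blue a && blue b ==> ~~ blue_arc I s (src a) (dst b)) P.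
    apply: sub_in_pairwise (filter_all _ _) => a b /= ra rb.
    have {}ra : blue a := ra; have {}rb : blue b := rb.
    by rewrite blueE ra rb.
  apply: pairwise_split => P1 a P2 b P3 eP; apply/implyP => /andP[ra rb].
  rewrite eP in augP.
  apply: (no_shortcut (c := Arc Blue (src a) (dst b)) augP) => //=.
    by case: (arc_colour a) ra.
  by case: (arc_colour b) rb.
- split=> // u; rewrite eY' (perm_big (map pair bs)) ?perm_rev //=.
  rewrite big_map big_filter -sumrN; congr (_ + _).
  apply: eq_big => [[[] e f]|a _] //=; lia.
Qed.

(** The indicator of [X] minus that of [Y] determines both differences, and its
    change along the path telescopes to source minus sink. *)
Lemma augment_differences P :
  X \in optimal_bases M1 w1 -> Y \in optimal_bases M2 w2 ->
  augmenting_path I s P ->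
  exists v w, [/\ v \in Y :\: X, w \in X :\: Y,
    augmentX s P :\: augmentY s P = (X :\: Y) :\ w &
    augmentY s P :\: augmentX s P = (Y :\: X) :\ v].
Proof.
move=> oX oY augP; have [_ eX] := augmentX_optimal oX augP.
have [_ eY] := augmentY_optimal oY augP.
have [[v [w [vYX wXY /path_telescope tel]]] _] := augP.
have key u : (u \in augmentX s P)%:R - (u \in augmentY s P)%:R =
    (u \in X)%:R - (u \in Y)%:R + (u == v)%:R - (u == w)%:R :> int.
  have := tel u; rewrite eX eY (bigID (fun a => red a)) /=.
  move: (bigop _ _ _) (bigop _ _ _) => S1 S2; lia.
have [[vX vY] [wX wY]] : (v \notin X /\ v \in Y) /\ (w \in X /\ w \notin Y).
  by move: vYX wXY; rewrite !inE => /andP[-> ->] /andP[-> ->].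
have vw : v == w = false by apply: contraNF vX => /eqP ->.
have F := (eqxx, vw, eq_sym w v, negbTE vX, vY, wX, negbTE wY).
exists v, w; split=> //; apply/setP => u; move: (key u); rewrite !in_setD !in_set1.
  case: (eqVneq u w) => [->|_]; first rewrite !F /=.
    by case: (w \in augmentX s P); case: (w \in augmentY s P).
  case: (eqVneq u v) => [->|_]; first rewrite !F /=.
    by case: (v \in augmentX s P); case: (v \in augmentY s P).
  by case: (u \in augmentX s P); case: (u \in augmentY s P);
     case: (u \in X); case: (u \in Y).
case: (eqVneq u v) => [->|_]; first rewrite !F /=.
  by case: (v \in augmentX s P); case: (v \in augmentY s P).
case: (eqVneq u w) => [->|_]; first rewrite !F /=.
  by case: (w \in augmentX s P); case: (w \in augmentY s P).
by case: (u \in augmentX s P); case: (u \in augmentY s P);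
   case: (u \in X); case: (u \in Y).
Qed.

End Digraph.


(** * The dual augmentation *)
Section DualStep.
Variables (R : realType) (E : finType) (I : instance R E) (s : state R E).
Implicit Types (P : seq (Defs.arc E)) (a b : Defs.arc E) (u v w : E) (d : R).

Local Notation X := (solX s).
Local Notation Y := (solY s).
Local Notation M1 := (mat1 I).
Local Notation M2 := (mat2 I).
Local Notation w1 := (rcost1 I s).
Local Notation w2 := (rcost2 I s).
Local Notation reach := (reachable I s).

(** The exchanges over which the step length minimizes: those whose reduced cost
    drops when the potentials are shifted. *)
Definition crossing1 e f :=
  [&& exchangeable M1 X e f, e \in reach & f \notin reach].
Definition crossing2 g f :=
  [&& exchangeable M2 Y g f, f \in reach & g \notin reach].

Lemma delta1E : delta1 I s =
  \big[mine/+oo%E]_(p : E * E | crossing1 p.1 p.2) (w1 p.1 - w1 p.2)%:E.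
Proof.
apply: eq_bigl => -[e f] /=; rewrite /crossing1 /exchangeable !in_setD.
by case: (e \in X); case: (f \in X); case: (e \in reach); case: (f \in reach);
   rewrite ?andbF ?andbT.
Qed.

Lemma delta2E : delta2 I s =
  \big[mine/+oo%E]_(p : E * E | crossing2 p.1 p.2) (w2 p.1 - w2 p.2)%:E.
Proof.
apply: eq_bigl => -[g f] /=; rewrite /crossing2 /exchangeable in_setU in_setI.
by case: (g \in Y); case: (f \in Y); case: (f \in reach); case: (g \in reach);
   rewrite ?andbF ?andbT.
Qed.

Variant step_length_spec : \bar R -> Prop :=
  | StepFinite d of
      (forall e f, crossing1 e f -> d <= w1 e - w1 f) &
      (forall g f, crossing2 g f -> d <= w2 g - w2 f) &
      (exists e f, crossing1 e f /\ d = w1 e - w1 f) \/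
      (exists g f, crossing2 g f /\ d = w2 g - w2 f) :
    step_length_spec d%:E
  | StepInfinite of (forall e f, ~~ crossing1 e f) &
      (forall g f, ~~ crossing2 g f) : step_length_spec +oo%E.

Lemma step_lengthP : step_length_spec (step_length I s).
Proof.
rewrite /step_length delta1E delta2E.
set m1 := bigop _ _ _; set m2 := bigop _ _ _.
have le1 e f : crossing1 e f -> (m1 <= (w1 e - w1 f)%:E)%E.
  by move=> ef; apply: (bigmin_inf (e, f)).
have le2 g f : crossing2 g f -> (m2 <= (w2 g - w2 f)%:E)%E.
  by move=> gf; apply: (bigmin_inf (g, f)).
have gt1 d : (m1 <= d%:E)%E -> exists e f, crossing1 e f /\ w1 e - w1 f <= d.
  by case/bigmin_leP=> [//|[[e f] ef]]; rewrite lee_fin; exists e, f.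
have gt2 d : (m2 <= d%:E)%E -> exists g f, crossing2 g f /\ w2 g - w2 f <= d.
  by case/bigmin_leP=> [//|[[g f] gf]]; rewrite lee_fin; exists g, f.
have min1 : (mine m1 m2 <= m1)%E by rewrite ge_min lexx.
have min2 : (mine m1 m2 <= m2)%E by rewrite ge_min lexx orbT.
case em : (mine m1 m2) => [d||].
- rewrite em in min1 min2.
  have {}le1 e f : crossing1 e f -> d <= w1 e - w1 f.
    by move=> /le1 le; rewrite -lee_fin; apply: le_trans le.
  have {}le2 g f : crossing2 g f -> d <= w2 g - w2 f.
    by move=> /le2 le; rewrite -lee_fin; apply: le_trans le.
  apply: StepFinite => //.
  have : (mine m1 m2 <= d%:E)%E by rewrite em.
  rewrite ge_min => /orP[/gt1|/gt2] [e [f [ef led]]]; [left|right];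
    exists e, f; split=> //; apply/eqP; rewrite eq_le led andbT.
    exact: le1.
  exact: le2.
- rewrite em in min1 min2; apply: StepInfinite => e f.
    by apply/negP => /le1 /(le_trans min1).
  by apply/negP => /le2 /(le_trans min2).
- have : (-oo < mine m1 m2)%E.
    rewrite lt_min; apply/andP; split; apply/bigmin_gtP; split=> // p _;
    exact: ltNyr.
  by rewrite em ltxx.
Qed.

(** With [R] the reachable set, any bases satisfy
    [|X' n Y'| <= |X' n R| + |Y' \ R|].  Without crossing exchanges both terms are
    largest at [X] and [Y], where the bound is attained because [R] contains
    [Y \ X] and misses [X \ Y]. *)
Lemma no_crossing_card :
  (forall e f, ~~ crossing1 e f) -> (forall g f, ~~ crossing2 g f) ->
  X \in bases M1 -> Y \in bases M2 -> (forall P, ~ augmenting_path I s P) ->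
  forall X' Y', X' \in bases M1 -> Y' \in bases M2 ->
  (#|X' :&: Y'| <= #|X :&: Y|)%N.
Proof.
move=> no1 no2 bX bY no X' Y' bX' bY'.
have leX := no_exchange_card (U := reach) bX bX' _.
have leY := no_exchange_card (U := ~: reach) bY bY' _.
have {}leX : (#|X' :&: reach| <= #|X :&: reach|)%N.
  apply: leX => e f ef eR; have := no1 e f.
  by rewrite /crossing1 ef eR negbK.
have {}leY : (#|Y' :&: ~: reach| <= #|Y :&: ~: reach|)%N.
  apply: leY => g f gf; rewrite !in_setC => gR; have := no2 g f.
  by rewrite /crossing2 gf gR andbT.
have : (#|X' :&: Y'| <= #|X' :&: reach| + #|Y' :&: ~: reach|)%N.
  rewrite -(cardsID reach (X' :&: Y')) leq_add // subset_leq_card //.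
    by rewrite setSI // subsetIl.
  by rewrite setDE setSI // subsetIr.
have : (#|X :&: reach| + #|Y :&: ~: reach| <= #|X :&: Y|)%N.
  rewrite -(cardsID reach (X :&: Y)) leq_add // subset_leq_card //.
    apply/subsetP => u; rewrite !in_setI => /andP[uX uR]; rewrite uX uR andbT /=.
    by apply: contraTT uR => uY; apply: (sink_unreachable no); rewrite inE uX uY.
  apply/subsetP => u; rewrite !(in_setI, in_setD, in_setC) => /andP[uY uR].
  rewrite uY uR andbT /=; apply: contraNT uR => uX.
  by apply: (subsetP (source_reachable I s)); rewrite inE uX uY.
lia.
Qed.

Variable d : R.
Hypothesis (step_d : step_length I s = d%:E).
Local Notation s' := (dual_augmentation I s d).

Lemma rcost1_dual u :
  rcost1 I s' u = w1 u - (if u \in reach then d else 0).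
Proof. by rewrite /rcost1 /=; case: ifP => _; lra. Qed.

Lemma rcost2_dual u :
  rcost2 I s' u = w2 u - (if u \in reach then 0 else d).
Proof. by rewrite /rcost2 /=; case: ifP => _; lra. Qed.

Lemma step_bounds :
  [/\ forall e f, crossing1 e f -> d <= w1 e - w1 f,
      forall g f, crossing2 g f -> d <= w2 g - w2 f &
      (exists e f, crossing1 e f /\ d = w1 e - w1 f) \/
      (exists g f, crossing2 g f /\ d = w2 g - w2 f)].
Proof. by move: step_d; case: step_lengthP => // d' ? ? ? [<-]. Qed.

Lemma step_length_ge0 :
  X \in optimal_bases M1 w1 -> Y \in optimal_bases M2 w2 -> 0 <= d.
Proof.
move=> oX oY; have [_ _ att] := step_bounds.
case: att => -[e [f [/and3P[ef _ _] ->]]].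
  by rewrite subr_ge0; apply: optimal_exchange ef.
by rewrite subr_ge0; apply: optimal_exchange ef.
Qed.

(** Only exchanges crossing the reachable set from inside to outside become
    cheaper, by [d], and the step length is at most their slack. *)
Lemma dual_optimalX : 0 <= d -> X \in optimal_bases M1 w1 ->
  X \in optimal_bases M1 (rcost1 I s').
Proof.
move=> d0 oX; have [bX _] := optimal_basesP _ _ _ oX.
apply: locally_optimal => // e f ef; rewrite !rcost1_dual.
have := optimal_exchange oX ef; have [le1 _ _] := step_bounds.
have := le1 e f; rewrite /crossing1 ef /=.
case: (e \in reach); case: (f \in reach) => /= cross loc;
  try move/(_ isT) in cross; lra.
Qed.

Lemma dual_optimalY : 0 <= d -> Y \in optimal_bases M2 w2 ->
  Y \in optimal_bases M2 (rcost2 I s').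
Proof.
move=> d0 oY; have [bY _] := optimal_basesP _ _ _ oY.
apply: locally_optimal => // g f gf; rewrite !rcost2_dual.
have := optimal_exchange oY gf; have [_ le2 _] := step_bounds.
have := le2 g f; rewrite /crossing2 gf /=.
case: (f \in reach); case: (g \in reach) => /= cross loc;
  try move/(_ isT) in cross; lra.
Qed.

Lemma dual_arc a : src a \in reach -> dst a \in reach ->
  is_arc I s' a = is_arc I s a.
Proof.
case: a => -[] u v /= uR vR; rewrite /is_arc /=.
  by rewrite !red_arcE !rcost1_dual uR vR (inj_eq (addIr _)).
by rewrite !blue_arcE !rcost2_dual uR vR !subr0.
Qed.

(** Arcs inside the reachable set keep their reduced costs on both ends in step,
    so all paths survive; an exchange attaining the step length becomes an arc
    that leaves the old reachable set. *)
Lemma reachable_dual : (#|reach| < #|reachable I s'|)%N.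
Proof.
have sub : reach \subset reachable I s'.
  apply/subsetP => w /reachableP[v [P [vYX Pw]]]; apply/reachableP.
  exists v, P; split=> //; move: Pw (path_reachable vYX Pw).1.
  rewrite /alternating_path => /and5P[al -> -> -> ->] allR; rewrite !andbT.
  elim: P al allR => //= a P IH /andP[ar al] /andP[/andP[aR bR] allR].
  by rewrite dual_arc // ar IH.
apply/proper_card/properP; split=> //.
have [_ _ att] := step_bounds.
case: att => [[e [f [/and3P[ef eR fR] de]]]|[g [f [/and3P[gf fR gR] de]]]].
  exists f => //; apply: (@reachable_arc _ _ I s' (Arc Red e f)) => /=; last first.
    exact: (subsetP sub).
  rewrite /is_arc /= red_arcE ef !rcost1_dual eR (negbTE fR) /=.
  by apply/eqP; rewrite de; lra.
exists g => //; apply: (@reachable_arc _ _ I s' (Arc Blue f g)) => /=; last first.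
  exact: (subsetP sub).
rewrite /is_arc /= blue_arcE gf !rcost2_dual fR (negbTE gR) /=.
by apply/eqP; rewrite de; lra.
Qed.

(** A finite step length is attained by an exchange with one end in the
    reachable set.  This is why [budget] starts counting at the second vertex. *)
Lemma reachable_neq0 : (0 < #|reach|)%N.
Proof.
have [_ _ att] := step_bounds.
case: att => [[e [f [/and3P[_ eR _] _]]]|[g [f [/and3P[_ fR _] _]]]].
  by apply/card_gt0P; exists e.
by apply/card_gt0P; exists f.
Qed.

End DualStep.

(** * Optimality certificates *)
Section Certificate.
Variables (R : realType) (E : finType).
Implicit Types (I : instance R E) (s : state R E) (X Y : {set E}).
Implicit Types (P : seq (Defs.arc E)) (c : config R E).

Definition at_card I k := Instance (mat1 I) (mat2 I) (cost1 I) (cost2 I) k.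

(** The dual solution and complementary slackness conditions of the Lagrangian
    relaxation of the constraint on [#|X :&: Y|]. *)
Record certificate I s : Prop := Certificate {
  cert_X : solX s \in optimal_bases (mat1 I) (rcost1 I s);
  cert_Y : solY s \in optimal_bases (mat2 I) (rcost2 I s);
  cert_lam : forall e, alpha s e + beta s e = lam s;
  cert_alpha : forall e, 0 <= alpha s e;
  cert_beta : forall e, 0 <= beta s e;
  cert_slackX : forall e, e \in solX s :\: solY s -> alpha s e = 0;
  cert_slackY : forall e, e \in solY s :\: solX s -> beta s e = 0 }.

Lemma cost_penalty (a b : E -> R) (l : R) X Y :
  (forall e, a e + b e = l) ->
  cost a X + cost b Y =
    l *+ #|X :&: Y| + cost a (X :\: Y) + cost b (Y :\: X).
Proof.
move=> abl; rewrite /cost (big_setID Y) /= [X in _ + X](big_setID X) /=.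
rewrite (setIC Y X) addrACA addrA -big_split /= -sumr_const.
by congr (_ + _ + _); apply: eq_bigr.
Qed.

(** Weak duality: in [cost_penalty] the last two terms are nonnegative for every
    pair of bases and vanish for the certified pair. *)
Lemma certificate_optimal I s : certificate I s ->
  optimal (at_card I #|solX s :&: solY s|) (solX s) (solY s).
Proof.
case=> /optimal_basesP[bX oX] /optimal_basesP[bY oY] lamE a0 b0 aX bYX.
have splitX X : cost (cost1 I) X = cost (rcost1 I s) X + cost (alpha s) X.
  by rewrite /cost -big_split /=; apply: eq_bigr => e _; rewrite /rcost1 subrK.
have splitY Y : cost (cost2 I) Y = cost (rcost2 I s) Y + cost (beta s) Y.
  by rewrite /cost -big_split /=; apply: eq_bigr => e _; rewrite /rcost2 subrK.
split=> // X' Y' [/= bX' bY' cardXY'].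
rewrite !splitX !splitY; have := oX _ bX'; have := oY _ bY'.
have := cost_penalty X' Y' lamE; have := cost_penalty (solX s) (solY s) lamE.
have aX' : 0 <= cost (alpha s) (X' :\: Y') by apply: sumr_ge0.
have bY'' : 0 <= cost (beta s) (Y' :\: X') by apply: sumr_ge0.
have -> : cost (alpha s) (solX s :\: solY s) = 0 by apply: big1.
have -> : cost (beta s) (solY s :\: solX s) = 0 by apply: big1.
rewrite cardXY'; lra.
Qed.

Lemma certificate_initial I X Y :
  unconstrained_optimal I X Y -> certificate I (initial_state R X Y).
Proof.
case=> bX bY opt; split=> //= [||e]; last by rewrite addr0.
- apply/optimal_basesP; split=> // X' bX'; have := opt _ _ bX' bY.
  have e0 Z : cost (rcost1 I (initial_state R X Y)) Z = cost (cost1 I) Z.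
    by apply: eq_bigr => e _; rewrite /rcost1 subr0.
  by rewrite !e0 lerD2r.
- apply/optimal_basesP; split=> // Y' bY'; have := opt _ _ bX bY'.
  have e0 Z : cost (rcost2 I (initial_state R X Y)) Z = cost (cost2 I) Z.
    by apply: eq_bigr => e _; rewrite /rcost2 subr0.
  by rewrite !e0 lerD2l.
Qed.

Lemma certificate_primal I s P : certificate I s -> augmenting_path I s P ->
  certificate I (primal_augmentation s P) /\
  #|augmentX s P :&: augmentY s P| = #|solX s :&: solY s|.+1.
Proof.
case=> oX oY lamE a0 b0 aX bY augP.
have [oX' _] := augmentX_optimal oX augP.
have [oY' _] := augmentY_optimal oY augP.
have [v [w [vYX wXY eX eY]]] := augment_differences oX oY augP.
split.
  split=> //= e.
    by rewrite eX in_setD1 => /andP[_ /aX].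
  by rewrite eY in_setD1 => /andP[_ /bY].
have [[bX _] [bX' _]] := (optimal_basesP _ _ _ oX, optimal_basesP _ _ _ oX').
have := card_basis_eq bX bX'; rewrite -(cardsID (solY s) (solX s)).
rewrite -(cardsID (augmentY s P) (augmentX s P)) eX.
by rewrite (cardsD1 w (solX s :\: solY s)) wXY; lia.
Qed.

Lemma certificate_dual I s d : certificate I s ->
  (forall P, ~ augmenting_path I s P) -> step_length I s = d%:E ->
  certificate I (dual_augmentation I s d).
Proof.
case=> oX oY lamE a0 b0 aX bY no step_d.
have d0 := step_length_ge0 step_d oX oY.
split=> /=; [exact: dual_optimalX|exact: dual_optimalY|..] => e.
- by rewrite -(lamE e); case: ifP => _; lra.
- by case: ifP => _; rewrite ?addr_ge0.
- by case: ifP => _; rewrite ?addr_ge0.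
- by move=> eXY; rewrite (negbTE (sink_unreachable no eXY)) aX.
- by move=> eYX; rewrite (subsetP (source_reachable I s)) // bY.
Qed.

End Certificate.

(** * Dualizing the second matroid *)
Section DualInstance.
Variables (R : realType) (E : finType) (I : instance R E).
Hypothesis (rank_ok : (inter_card I <= rk (mat1 I))%N).
Implicit Types (X Y Z : {set E}).

Lemma card_setI_compl X Z : X \in bases (mat1 I) ->
  (#|X :&: Z| + #|X :&: ~: Z| = rk (mat1 I))%N.
Proof. by move=> bX; rewrite -setDE cardsID (card_basis bX). Qed.

Lemma feasible_dual X Z :
  feasible (dual_instance I) X Z <-> feasible I X (~: Z).
Proof.
by split=> -[/= bX bZ cXZ]; split=> //=;
  [move: bZ|move: (card_setI_compl Z bX)|move: bZ|move: (card_setI_compl Z bX)];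
  rewrite ?dual_basesE //; lia.
Qed.

Lemma cost_dual Z :
  cost (cost2 (dual_instance I)) Z = cost (cost2 I) (~: Z) - cost (cost2 I) setT.
Proof.
rewrite /cost /= sumrN [X in _ = _ - X](big_setID Z) /= setTI setTD; lra.
Qed.

(** Complementing the second basis shifts all costs by the same constant,
    [cost2 I] of the ground set. *)
Lemma optimal_dual X Z : optimal (dual_instance I) X Z -> optimal I X (~: Z).
Proof.
case=> /feasible_dual fXZ opt; split=> // X' Y' fXY'.
have /opt : feasible (dual_instance I) X' (~: Y').
  by apply/feasible_dual; rewrite setCK.
by rewrite !cost_dual setCK /=; lra.
Qed.

Lemma unconstrained_dual X Y :
  unconstrained_optimal I X Y -> unconstrained_optimal (dual_instance I) X (~: Y).
Proof.
case=> bX bY opt; split=> //=; first by rewrite dual_basesE setCK.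
move=> X' Z bX'; rewrite dual_basesE => bZ; have := opt _ _ bX' bZ.
by rewrite !cost_dual setCK; lra.
Qed.

End DualInstance.

(** * Runs of the algorithm *)
Section Execution.
Variables (R : realType) (E : finType).
Implicit Types (I : instance R E) (s : state R E) (X Y : {set E}).
Implicit Types (P : seq (Defs.arc E)) (c : config R E).

Definition terminal c :=
  match c with Returned _ _ | InfeasibleInstance => true | _ => false end.

Lemma progress c : ~~ terminal c -> exists b c', step c b c'.
Proof.
elim: c => //= [I X Y|I s|c IH] _.
- have [lt|gt|eq] := ltngtP #|X :&: Y| (inter_card I).
  + by exists false, (While I (initial_state R X Y)); apply: step_init.
  + exists false, (InDual (Begin (dual_instance I) X (~: Y))).
    exact: step_dualize.
  + by exists false, (Returned X Y); apply: step_return.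
- have [le|lt] := leqP (inter_card I) #|solX s :&: solY s|.
    by exists false, (Returned (solX s) (solY s)); apply: step_exit.
  case: (EM (exists P, augmenting_path I s P)) => [[P augP]|no].
    by exists true, (While I (primal_augmentation s P)); apply: step_primal.
  have {}no P : ~ augmenting_path I s P by move=> augP; apply: no; exists P.
  case E0 : (step_length I s) (step_lengthP I s) => [d||] // sp.
    by exists true, (While I (dual_augmentation I s d)); apply: step_dual.
  - by exists false, InfeasibleInstance; apply: step_infeasible.
  - by inversion sp.
- case: (boolP (terminal c)) => [|/IH[b [c' st]]]; last first.
    by exists b, (InDual c'); apply: step_in_dual.
  case: c {IH} => // [X Z|] _.
    by exists false, (Returned X (~: Z)); constructor.
  by exists false, InfeasibleInstance; constructor.
Qed.

Lemma dual_rank I :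
  (inter_card (dual_instance I) <= rk (mat1 (dual_instance I)))%N.
Proof. exact: leq_subr. Qed.

(** The invariant of the computation, relative to the instance [I] that it is
    meant to solve; inside a dual run this is the dual instance. *)
Fixpoint sound I c : Prop :=
  match c with
  | Begin I' X Y => I' = I /\ unconstrained_optimal I X Y
  | While I' s => [/\ I' = I, certificate I s &
                      (#|solX s :&: solY s| <= inter_card I)%N]
  | InDual c' => sound (dual_instance I) c'
  | Returned X Y => optimal I X Y
  | InfeasibleInstance => forall X Y, ~ feasible I X Y
  end.

Lemma infeasible_above I s : certificate I s ->
  (forall P, ~ augmenting_path I s P) -> step_length I s = +oo%E ->
  forall m X Y, (#|solX s :&: solY s| < m)%N -> ~ feasible (at_card I m) X Y.
Proof.
case=> /optimal_basesP[bX _] /optimal_basesP[bY _] _ _ _ _ _ no.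
case: step_lengthP => // no1 no2 _ m X Y lt [/= bX' bY' cXY].
by have := no_crossing_card no1 no2 bX bY no bX' bY'; lia.
Qed.

Lemma sound_step I c b c' : (inter_card I <= rk (mat1 I))%N ->
  sound I c -> step c b c' -> sound I c'.
Proof.
move=> + + st; elim: {c b c'}st I => /=.
- move=> I X Y cXY _ _ [<- [bX bY opt]]; split=> // X' Y' [bX' bY' _].
  exact: opt.
- move=> I X Y _ _ _ [<- opt]; split=> //; exact: unconstrained_dual.
- move=> I X Y lt _ _ [<- opt]; split=> //; first exact: certificate_initial.
  exact: ltnW.
- move=> I s P lt augP _ _ [<- cert le]; split=> //.
    by have [] := certificate_primal cert augP.
  by rewrite (certificate_primal cert augP).2.
- move=> I s d lt no sd _ _ [<- cert le]; split=> //.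
  exact: certificate_dual.
- move=> I s lt no inf _ _ [<- cert le] X Y fXY.
  exact: (infeasible_above cert no inf (m := inter_card I) (X := X) (Y := Y)).
- move=> I s ge _ _ [<- cert le]; have := certificate_optimal cert.
  have -> : #|solX s :&: solY s| = inter_card I by apply/eqP; rewrite eqn_leq le.
  by case: (I).
- by move=> c b c' st IH I rI; apply: IH; apply: dual_rank.
- move=> X Z I rI; exact: optimal_dual.
- move=> I rI no X Y fXY; apply: (no X (~: Y)).
  by apply/(feasible_dual rI); rewrite setCK.
Qed.

(** An upper bound on the number of augmentations still to come: [#|E|] for each
    unit by which the intersection size differs from the target, minus the number
    of reachable vertices beyond the first, since each dual augmentation adds at
    least one of the at most [#|E|] vertices. *)
Fixpoint budget c : nat :=
  match c with
  | Begin J X Y =>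
      ((inter_card J - #|X :&: Y|) + (#|X :&: Y| - inter_card J)) * #|E|
  | While J s =>
      (inter_card J - #|solX s :&: solY s|) * #|E| - #|reachable J s|.-1
  | InDual c' => budget c'
  | _ => 0
  end.

(** Bounds the number of steps other than augmentations still to come.  A run is
    dualized at most once, so a [Begin] that is about to dualize gets a value
    above that of a [Begin] wrapped in [InDual]. *)
Fixpoint stage c : nat :=
  match c with
  | Begin J X Y => if (inter_card J < #|X :&: Y|)%N then 4 else 2
  | While J s => 1
  | InDual c' => (stage c').+1
  | _ => 0
  end.

(** A primal augmentation pays with a whole [#|E|] for losing a reachable set of
    size at most [#|E|]; a dual one pays with the growth of the reachable set. *)
Lemma budget_step I c b c' : (inter_card I <= rk (mat1 I))%N ->
  sound I c -> step c b c' ->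
  (b + budget c' <= budget c)%N /\ (~~ b + stage c' <= stage c)%N.
Proof.
move=> + + st; elim: {c b c'}st I => /=.
- by move=> I X Y -> _ _ _; rewrite ltnn; split; lia.
- move=> I X Y lt I' rI [eI [bX _ _]]; subst I'.
  have := card_setI_compl Y bX; rewrite lt => cXY.
  have -> : (rk (mat1 I) - inter_card I < #|X :&: ~: Y|)%N = false by lia.
  by split=> //; rewrite leq_mul2r; apply/orP; right; lia.
- move=> I X Y lt _ _ _; rewrite ltnNge (ltnW lt) /=; split=> //.
  by apply: leq_trans (leq_subr _ _) _; rewrite leq_mul2r leq_addr orbT.
- move=> I s P lt augP I' _ [eI cert _]; subst I'; split=> //.
  have [_ /= ->] := certificate_primal cert augP.
  have leE : (#|reachable I s| <= #|E|)%N := max_card _.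
  have : (0 < #|E|)%N.
    by case: augP => -[v _] _; apply/card_gt0P; exists v.
  move: #|_ :&: _| lt => j; case: (inter_card I) => // k; rewrite ltnS => lt.
  rewrite subSS (subSn lt) mulSn; move: (_ * _)%N => m.
  by move: leE; move: #|reachable I s| #|reachable I _| #|E| => r r' e; lia.
- move=> I s d lt no sd I' _ [eI cert _]; subst I'; split=> //=.
  have := reachable_dual sd; have := reachable_neq0 sd.
  have leE : (#|reachable I (dual_augmentation I s d)| <= #|E|)%N := max_card _.
  move: #|_ :&: _| lt => j; case: (inter_card I) => // k; rewrite ltnS => lt.
  rewrite (subSn lt) mulSn; move: (_ * _)%N => m.
  by move: leE; move: #|reachable I s| #|reachable I _| #|E| => r r' e; lia.
- by [].
- by [].
- move=> c b c' st IH I rI so.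
  have [] := IH (dual_instance I) _ so; first by exact: dual_rank.
  by split=> //; rewrite addnS.
- by [].
- by [].
Qed.

Lemma sound_terminates I c : (inter_card I <= rk (mat1 I))%N ->
  sound I c -> terminates c.
Proof.
move=> rI; have [n] := ubnP (budget c + stage c).
elim: n c => [|n IH] c; first by rewrite ltn0.
rewrite ltnS => le so; apply: Acc_intro => c' [b st].
apply: IH (sound_step rI so st); apply: leq_trans le.
by have := budget_step rI so st; case: b {st} => /=; lia.
Qed.

Lemma run_head c tr n : run c tr n -> exists tr', tr = c :: tr'.
Proof. by case=> [c0|c0 b c' tr' n' _ _]; [exists [::]|exists tr']. Qed.

Lemma sound_run I c tr n : (inter_card I <= rk (mat1 I))%N ->
  sound I c -> run c tr n ->
  sound I (last c tr) /\ (n + budget (last c tr) <= budget c)%N.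
Proof.
move=> rI + rn; elim: rn => {c tr n} [c|c b c' tr n st rn IH] so //=.
have so' := sound_step rI so st; have [] := IH so'.
have [tr' ->] := run_head rn => /= solast le; split=> //.
by have [] := budget_step rI so st; lia.
Qed.

Lemma halted_terminal c : halted c -> terminal c.
Proof. by move=> h; apply: contraT => /progress[b [c' /h]]. Qed.

Lemma sound_answer I c : sound I c -> terminal c -> correct_answer I c.
Proof. by case: c. Qed.

Lemma sound_pair_optimal I c X Y : (inter_card I <= rk (mat1 I))%N ->
  sound I c -> current_pair c = Some (X, Y) ->
  optimal (at_card I #|X :&: Y|) X Y.
Proof.
elim: c I X Y => //= [J X' Y' I|J s I|c IH I|X' Y' I] X Y rI.
- case=> _ [bX bY opt] [<- <-]; split=> // X1 Y1 [bX1 bY1 _]; exact: opt.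
- by case=> _ cert _ [<- <-]; apply: certificate_optimal.
- case eZ: current_pair => [[X1 Z]|] //= so [<- <-].
  have opt := IH (dual_instance I) X1 Z (dual_rank I) so eZ.
  have bX1 : X1 \in bases (mat1 I) by case: opt => -[].
  have cXZ := card_setI_compl Z bX1.
  apply: optimal_dual => /=; first by rewrite -cXZ leq_addl.
  by rewrite /dual_instance /= -cXZ addnK.
- move=> opt [<- <-]; have [[_ _ ->] _] := opt.
  by case: (I) opt.
Qed.

Lemma computed_optimal I c tr n X Y : (inter_card I <= rk (mat1 I))%N ->
  sound I c -> run c tr n -> (X, Y) \in pmap (@current_pair R E) tr ->
  optimal (at_card I #|X :&: Y|) X Y.
Proof.
move=> rI + rn; elim: rn => {c tr n} [c|c b c' tr n st rn IH] so /=.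
  case e: current_pair => [p|] //=; rewrite inE => /eqP eXY.
  by apply: sound_pair_optimal so _; rewrite // e eXY.
have {}IH := IH (sound_step rI so st).
case e: current_pair => [p|] //=; rewrite inE => /orP[/eqP eXY|//].
by apply: sound_pair_optimal so _; rewrite // e eXY.
Qed.

(** Unordered: the intersection size increases in a direct run and decreases in
    the original coordinates of a dual run. *)
Definition between i m k := ((i <= m <= k) || (k <= m <= i))%N.

(** Discrete continuity of the intersection size: it cannot jump over a size on
    its way to the target, and if the run gives up, the sizes not yet reached are
    infeasible. *)
Lemma pair_step I c b c' X Y m : (inter_card I <= rk (mat1 I))%N ->
  sound I c -> step c b c' -> current_pair c = Some (X, Y) ->
  between #|X :&: Y| m (inter_card I) -> m != #|X :&: Y| ->
  (exists X' Y', current_pair c' = Some (X', Y') /\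
     between #|X' :&: Y'| m (inter_card I)) \/
  (forall X' Y', ~ feasible (at_card I m) X' Y').
Proof.
move=> + + st; elim: {c b c'}st I X Y m => /=.
- move=> I X Y eq I' X1 Y1 m _ [eI _] [<- <-] bet _; left; by exists X, Y.
- move=> I X Y lt I' X1 Y1 m _ [eI _] [<- <-] bet _; left.
  by exists X, Y; rewrite /= setCK.
- move=> I X Y lt I' X1 Y1 m _ [eI _] [<- <-] bet _; left; by exists X, Y.
- move=> I s P lt augP I' X1 Y1 m _ [eI cert _] [<- <-] bet nm; subst I'; left.
  exists (augmentX s P), (augmentY s P); split=> //.
  rewrite (certificate_primal cert augP).2; move: bet nm; rewrite /between; lia.
- move=> I s d lt no sd I' X1 Y1 m _ [eI cert _] [<- <-] bet _; left.
  by exists (solX s), (solY s).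
- move=> I s lt no inf I' X1 Y1 m _ [eI cert _] [<- <-] bet nm; subst I'.
  right=> X' Y'; apply: infeasible_above cert no inf _ _ _ _.
  by move: bet nm; rewrite /between; lia.
- move=> I s ge I' X1 Y1 m _ [eI cert _] [<- <-] bet _; left.
  by exists (solX s), (solY s).
- move=> c b c' st IH I X Y m rI so.
  case eZ: (current_pair c) => [[X1 Z]|] //= [<- <-] bet nm.
  have opt := sound_pair_optimal (dual_rank I) so eZ.
  have bX1 : X1 \in bases (mat1 I) by case: opt => -[].
  have cXZ := card_setI_compl Z bX1.
  have lem : (m <= rk (mat1 I))%N by move: bet; rewrite /between; lia.
  have [||[X' [Z' [eZ' bet']]]|no] := IH (dual_instance I) X1 Z (rk (mat1 I) - m)%N
    (dual_rank I) so eZ.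
  + by move: bet; rewrite /between /=; lia.
  + by apply: contraNneq nm; lia.
  + left; exists X', (~: Z'); rewrite eZ'; split=> //.
    have so' := sound_step (dual_rank I) so st.
    have opt' := sound_pair_optimal (dual_rank I) so' eZ'.
    have bX' : X' \in bases (mat1 I) by case: opt' => -[].
    have := card_setI_compl Z' bX'.
    by move: bet'; rewrite /between /=; lia.
  + right=> X' Y' fXY; apply: (no X' (~: Y')).
    by apply/(feasible_dual (I := at_card I m)) => //; rewrite setCK.
- move=> X Z I X1 Y1 m _ _ [<- <-] bet _; left; by exists X, (~: Z).
- by [].
Qed.

Lemma computed_complete I c tr n X Y m : (inter_card I <= rk (mat1 I))%N ->
  sound I c -> run c tr n -> halted (last c tr) ->
  current_pair c = Some (X, Y) -> between #|X :&: Y| m (inter_card I) ->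
  (exists X' Y', feasible (at_card I m) X' Y') ->
  exists X' Y', (X', Y') \in pmap (@current_pair R E) tr /\ #|X' :&: Y'| = m.
Proof.
move=> rI + rn; elim: rn X Y => {c tr n} [c|c b c' tr n st rn IH] X Y so /=.
  move=> /halted_terminal term eXY bet _; exists X, Y; rewrite eXY inE eqxx.
  split=> //; case: c term so eXY => //= X1 Y1 _ [[_ _ eq] _] [eX eY].
  by move: bet; rewrite -eX -eY eq /between; lia.
have so' := sound_step rI so st.
have -> : last c tr = last c' tr by have [tr' ->] := run_head rn.
move=> hl eXY bet ex; rewrite eXY /=.
have [eqm|nm] := eqVneq m #|X :&: Y|.
  by exists X, Y; rewrite inE eqxx eqm.
have [[X' [Y' [eXY' bet']]]|no] := pair_step rI so st eXY bet nm.
  have [X2 [Y2 [mem2 e2]]] := IH _ _ so' hl eXY' bet' ex.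
  by exists X2, Y2; rewrite inE mem2 orbT.
by case: ex => X' [Y' /no].
Qed.

End Execution.

Theorem theorem3 (R : realType) (E : finType) (M1 M2 : matroid E)
    (c1 c2 : E -> R) :
  let K := minn (rk M1) (rk M2) in
  let P k := Instance M1 M2 c1 c2 k in
  (forall (k : nat) (X Y : {set E}), (k <= K)%N ->
     unconstrained_optimal (P k) X Y ->
     terminates (Begin (P k) X Y) /\
     forall tr n, run (Begin (P k) X Y) tr n ->
       (n <= (if #|X :&: Y| <= k then k else rk M1 - k) * #|E|)%N /\
       (halted (last (Begin (P k) X Y) tr) ->
        correct_answer (P k) (last (Begin (P k) X Y) tr)))
  /\
  (forall (X Y : {set E}) tr0 n0 trK nK, unconstrained_optimal (P 0%N) X Y ->
     complete_run (Begin (P 0%N) X Y) tr0 n0 ->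
     complete_run (Begin (P K) X Y) trK nK ->
     let computed := pmap (@current_pair R E) (tr0 ++ trK) in
     (n0 + nK <= #|E| ^ 2)%N /\
     forall k : nat, (k <= K)%N ->
       (forall X' Y', (X', Y') \in computed -> #|X' :&: Y'| = k ->
          optimal (P k) X' Y') /\
       ((exists X' Y', feasible (P k) X' Y') ->
        exists X' Y', (X', Y') \in computed /\ #|X' :&: Y'| = k)).
Proof.
move=> K P.
have rank k : (k <= K)%N -> (inter_card (P k) <= rk (mat1 (P k)))%N.
  by move=> /leq_trans; apply; rewrite geq_minl.
split=> [k X Y kK opt|X Y tr0 n0 trK nK opt [run0 halt0] [runK haltK] computed].
  have so : sound (P k) (Begin (P k) X Y) by [].
  split; first exact: sound_terminates (rank k kK) so.
  move=> tr n rn; have [so' le] := sound_run (rank k kK) so rn.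
  split; last by move=> /halted_terminal; apply: sound_answer.
  have {le} : (n <= budget (Begin (P k) X Y))%N.
    by apply: leq_trans le; apply: leq_addr.
  move=> /leq_trans; apply; rewrite /= leq_mul2r; apply/orP; right.
  have [bX _ _] := opt.
  have leI : (#|X :&: Y| <= rk M1)%N.
    by rewrite -(card_basis bX) subset_leq_card // subsetIl.
  by case: (leqP #|X :&: Y| k) => jk; lia.
have optK : unconstrained_optimal (P K) X Y by [].
have so0 : sound (P 0) (Begin (P 0) X Y) by [].
have soK : sound (P K) (Begin (P K) X Y) by [].
have r0 := rank 0 (leq0n K); have rK := rank K (leqnn K).
have [_ le0] := sound_run r0 so0 run0; have [_ leK] := sound_run rK soK runK.
have [bX bY _] := opt.
have jK : (#|X :&: Y| <= K)%N.
  rewrite leq_min -(card_basis bX) -(card_basis bY).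
  by rewrite !subset_leq_card ?subsetIl ?subsetIr.
have KE : (K <= #|E|)%N.
  by rewrite (leq_trans (geq_minl _ _)) // -(card_basis bX) max_card.
split.
  have {le0} : (n0 <= #|X :&: Y| * #|E|)%N.
    apply: leq_trans (leq_trans (leq_addr _ _) le0) _.
    by rewrite /= sub0n add0n subn0.
  have {leK} : (nK <= (K - #|X :&: Y|) * #|E|)%N.
    apply: leq_trans (leq_trans (leq_addr _ _) leK) _.
    by rewrite /= leq_mul2r; apply/orP; right; lia.
  move=> leK le0; apply: leq_trans (leq_add le0 leK) _.
  by rewrite -mulnDl subnKC // expnS expn1 leq_mul2r KE orbT.
move=> k kK; split=> [X' Y'|ex].
  rewrite /computed pmap_cat mem_cat => /orP[] mXY eq.
    by have := computed_optimal r0 so0 run0 mXY; rewrite eq.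
  by have := computed_optimal rK soK runK mXY; rewrite eq.
have [le|lt] := leqP k #|X :&: Y|.
  have [||X' [Y' [mXY eq]]] :=
    computed_complete r0 so0 run0 halt0 (erefl _) (m := k) => //.
    by rewrite /between /=; lia.
  by exists X', Y'; rewrite /computed pmap_cat mem_cat mXY.
have [||X' [Y' [mXY eq]]] :=
  computed_complete rK soK runK haltK (erefl _) (m := k) => //.
  by rewrite /between /=; lia.
by exists X', Y'; rewrite /computed pmap_cat mem_cat mXY orbT.
Qed.
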